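(* Let $p, q \in \mathbb{R}$. Then $$\int_{0}^{1} \frac{x^{p-1} - x^{q-1}}{1-x} \, dx = \psi(q) - \psi(p).$$
   Context: $\psi$ denotes the digamma function, $\psi(x) = \frac{d}{dx}\log\Gamma(x) = \Gamma'(x)/\Gamma(x)$, where $\Gamma$ is the gamma function defined by $\Gamma(x)=\int_0^\infty t^{x-1}e^{-t}\,dt$.
   Formalization: The formal statement takes p, q > 0 instead of arbitrary real p, q; if p or q is ≤ 0 and p ≠ q the integral diverges at 0 (e.g. p = −1/2, q = 1), and ψ is not defined there by the Euler integral. *)

(* Defs.v *)
From HB Require Import structures.
From mathcomp Require Import all_boot all_order all_algebra.
From mathcomp Require Import all_classical all_reals all_analysis.

Set Implicit Arguments.
Unset Strict Implicit.
Unset Printing Implicit Defensive.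

Import Order.TTheory GRing.Theory Num.Theory.
Import numFieldNormedType.Exports.

Local Open Scope classical_set_scope.
Local Open Scope ring_scope.

(* The integral is finite exactly for 0 < x; for x <= 0 it diverges and
   Rintegral returns the default value 0. *)
Definition Gamma (R : realType) (x : R) : R :=
  Rintegral lebesgue_measure `]0, +oo[ (fun t : R => t `^ (x - 1) * expR (- t)).

(* Only meaningful for 0 < x, see Gamma. *)
Definition digamma (R : realType) (x : R) : R :=
  derive1 (fun y : R => ln (Gamma y)) x.

(* Main.v *)
Require Import Defs.
From HB Require Import structures.
From mathcomp Require Import all_boot all_order all_algebra.
From mathcomp Require Import all_classical all_reals all_analysis.
From mathcomp Require Import measurable_realfun lra ring.

Import Order.TTheory GRing.Theory Num.Theory.
Import numFieldNormedType.Exports.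

Local Open Scope classical_set_scope.
Local Open Scope ring_scope.

Set Implicit Arguments.
Unset Strict Implicit.
Unset Printing Implicit Defensive.

(** Write psi for the digamma function and, for q > 0,
    Phi(q) = int_0^1 (1 - x^(q-1)) / (1 - x) dx. The integrand of the theorem is
    the difference of those of Phi(q) and Phi(p), so what has to be shown is
    that psi - Phi is constant. No series expansion is needed: both functions
    solve f(x + 1) = f(x) + 1/x, hence psi - Phi is 1-periodic, and both satisfy
    f(q + n) - f(p + n) -> 0, so the periodic function psi - Phi takes the same
    value at p and at q ([eq_increment_harmonic]).

    For Phi the difference equation is int_0^1 x^(q-1) dx = 1/q, and the decay
    of increments follows from the monotonicity of Phi together with the
    equation itself.

    For psi one first needs that ln Gamma is differentiable at all. Instead of
    differentiating under the integral sign, the proof uses the two properties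
    that characterise Gamma in the Bohr-Mollerup theorem: L = ln Gamma is convex
    ([ln_Gamma_convex]) and L(x + 1) = L(x) + ln x ([GammaS]). Convexity puts the
    difference quotients of L at a point y > 1, for steps shorter than 1, between
    ln(y - 1) and ln y ([convex_slope]). At y = x + n these bounds are close to
    each other, and the difference equation carries this back to x at the cost
    of a finite sum of logarithms, whose difference quotients converge. So the
    difference quotients at x satisfy the Cauchy criterion
    ([derivable_convex_ln_primitive]). The same bounds give
    ln(x - 1) <= psi(x) <= ln x for x > 1 ([digamma_bounds]), hence the decay of
    the increments of psi.

    The equation Gamma(x + 1) = x Gamma(x) is an integration by parts on
    ]0, +oo[, that is, the fundamental theorem of calculus applied to
    t^x e^(-t). Its derivative changes sign, and for x < 1 it is unbounded at 0;
    [integral_derive_dominated] covers this case by dominating the integrand by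
    the derivative of a bounded increasing function, here a multiple of
    (t / (1 + t))^x ([gamma_dominated]). *)

(** * The fundamental theorem of calculus on open intervals *)

(** The set A is the increasing union of the segments [u n, v n], on each of which
    the theorem for continuous functions on a segment applies; monotone
    convergence passes to the union. This handles primitives whose derivative is
    unbounded at the ends of A. *)
Lemma ge0_integral_deriveE {R : realType} (A : set R) (u v : R^nat)
    (f F : R -> R) (a b : R) :
  {homo u : m n / (m <= n)%N >-> n <= m} ->
  {homo v : m n / (m <= n)%N >-> m <= n} ->
  (forall n, u n < v n) -> A = \bigcup_n `[u n, v n]%classic ->
  (forall x, A x -> is_derive x 1 F (f x)) ->
  (forall x, A x -> {for x, continuous f}) ->
  (forall x, A x -> 0 <= f x) ->
  F (u n) @[n --> \oo] --> a -> F (v n) @[n --> \oo] --> b ->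
  (\int[lebesgue_measure]_(x in A) (f x)%:E = (b - a)%:E)%E.
Proof.
move=> u_dec v_inc uv AE dF cf f0 Fu Fv.
have sub n x : x \in `[u n, v n] -> A x by move=> xn; rewrite AE; exists n.
have cfn n : {within `[u n, v n], continuous f}.
  apply: continuous_in_subspaceT => x; rewrite inE => xn.
  exact/cf/(sub n).
have : (\int[lebesgue_measure]_(x in `[u n, v n]) (f x)%:E @[n --> \oo]
   --> \int[lebesgue_measure]_(x in A) (f x)%:E)%E.
  rewrite AE; apply: ge0_nondecreasing_set_cvg_integral.
  - move=> m n mn; rewrite subsetEset => x /=; rewrite !in_itv/= => /andP[h1 h2].
    by rewrite (le_trans (u_dec _ _ mn))// (le_trans h2)// v_inc.
  - by move=> n.
  - move=> n; apply/measurable_EFinP.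
    exact: subspace_continuous_measurable_fun.
  - by move=> n x xn; rewrite lee_fin f0//; apply: (sub n).
have -> : (fun n => \int[lebesgue_measure]_(x in `[u n, v n]) (f x)%:E)%E =
          (fun n => (F (v n) - F (u n))%:E).
  apply/funext => n; rewrite (@continuous_FTC2 _ f F)//.
  - have cF : {within `[u n, v n], continuous F}.
      apply: derivable_within_continuous => x xn.
      by have [] := dF x (sub n x xn).
    have /(continuous_within_itvP _ (uv n)) [_ Fa Fb] := cF.
    split => // x xn.
    have Ax : A x by apply: (sub n); apply: subset_itv_oo_cc xn.
    by have [] := dF x Ax.
  - move=> x xn; have Ax : A x by apply: (sub n); apply: subset_itv_oo_cc xn.
    by rewrite derive1E; have [_ ->] := dF x Ax.
move=> H; apply: (cvg_unique (@ereal_hausdorff R) H).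
by apply: cvg_EFin; [exact: nearW|exact: cvgB].
Qed.

(** Since g and g + f are nonnegative, the previous lemma gives both integrals,
    and the one of f by subtraction. *)
Lemma integral_derive_dominated {R : realType} (A : set R) (u v : R^nat)
    (f F g G : R -> R) (a b c d : R) :
  {homo u : m n / (m <= n)%N >-> n <= m} ->
  {homo v : m n / (m <= n)%N >-> m <= n} ->
  (forall n, u n < v n) -> A = \bigcup_n `[u n, v n]%classic ->
  (forall x, A x -> is_derive x 1 F (f x)) ->
  (forall x, A x -> is_derive x 1 G (g x)) ->
  (forall x, A x -> {for x, continuous f}) ->
  (forall x, A x -> {for x, continuous g}) ->
  (forall x, A x -> `|f x| <= g x) ->
  F (u n) @[n --> \oo] --> a -> F (v n) @[n --> \oo] --> b ->
  G (u n) @[n --> \oo] --> c -> G (v n) @[n --> \oo] --> d ->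
  lebesgue_measure.-integrable A (EFin \o f) /\
  \int[lebesgue_measure]_(x in A) f x = b - a.
Proof.
move=> u_dec v_inc uv AE dF dG cf cg fg Fu Fv Gu Gv.
have mA : measurable A by rewrite AE; exact: bigcup_measurable.
have mcont (h : R -> R) : (forall x, A x -> {for x, continuous h}) -> measurable_fun A h.
  move=> ch; rewrite AE; apply/measurable_fun_bigcup => // n.
  apply: subspace_continuous_measurable_fun => //.
  apply: continuous_in_subspaceT => x; rewrite inE => xn.
  by apply: ch; rewrite AE; exists n.
have g0 x : A x -> 0 <= g x by move=> Ax; exact: le_trans (fg x Ax).
have ig : (\int[lebesgue_measure]_(x in A) (g x)%:E = (d - c)%:E)%E.
  exact: (@ge0_integral_deriveE _ A u v g G).
have igf : (\int[lebesgue_measure]_(x in A) (g x + f x)%:E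
            = ((d + b) - (c + a))%:E)%E.
  apply: (@ge0_integral_deriveE _ A u v (fun x => g x + f x) (fun x => G x + F x)) => //.
  - by move=> x Ax; have := dF x Ax; have := dG x Ax; move=> ? ?; exact: is_deriveD.
  - by move=> x Ax; apply: cvgD; [exact: cg|exact: cf].
  - by move=> x Ax; have := fg x Ax; rewrite ler_norml => /andP[]; lra.
  - exact: cvgD.
  - exact: cvgD.
have intg : lebesgue_measure.-integrable A (EFin \o g).
  apply/integrableP; split; first by apply/measurable_EFinP; exact: mcont.
  apply: (le_lt_trans _ (ltry (d - c))); rewrite -ig le_eqVlt.
  apply/orP; left; apply/eqP; apply: eq_integral => x; rewrite inE => Ax.
  by rewrite /= ger0_norm// g0.
have intf : lebesgue_measure.-integrable A (EFin \o f).
  apply: le_integrable intg => //; first by apply/measurable_EFinP; exact: mcont.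
  by move=> x Ax; rewrite /= lee_fin (le_trans (fg x Ax))// ler_norm.
split => //.
have := @RintegralD _ _ _ (@lebesgue_measure R) A g f mA intg intf.
by rewrite {1 2}/Rintegral ig igf /=; lra.
Qed.

(** * Exhausting the two open intervals; powers on ]0, 1[ *)

Lemma continuous_powR {R : realType} (a x : R) :
  0 < x -> {for x, continuous (fun y : R => y `^ a)}.
Proof.
move=> x0; apply: differentiable_continuous; apply/derivable1_diffP.
by apply: derivable_powR; rewrite in_itv/= andbT.
Qed.

(** The offset 3 makes the bounds strictly ordered already for n = 0. *)
Lemma bigcup_itv01 {R : realType} :
  `]0, 1[%classic = \bigcup_n `[(n.+3%:R)^-1, 1 - (n.+3%:R)^-1 : R]%classic.
Proof.
apply/seteqP; split => x /=; rewrite in_itv/=.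
  move=> /andP[x0 x1].
  have m0 : 0 < Num.min x (1 - x) by rewrite lt_min x0 subr_gt0.
  have [n /ltW nm] : exists n, (Num.min x (1 - x))^-1 < n%:R.
    by exists (Num.bound (Num.min x (1 - x))^-1); rewrite archi_boundP// invr_ge0 ltW.
  exists n => //=; rewrite in_itv/=.
  suff : (n.+3%:R)^-1 <= Num.min x (1 - x) by rewrite le_min => /andP[-> H] /=; rewrite lerBrDr -lerBrDl.
  rewrite -[leRHS]invrK lef_pV2 ?posrE ?invr_gt0 ?ltr0n// (le_trans nm)// ler_nat.
  by do 3 apply: leqW.
move=> [n _ /=]; rewrite in_itv/= => /andP[].
have : 0 < (n.+3%:R : R)^-1 by rewrite invr_gt0 ltr0n.
move: (_^-1) => e e0 h1 h2; apply/andP; split; lra.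
Qed.

Lemma bigcup_itv0y {R : realType} :
  `]0, +oo[%classic = \bigcup_n `[(n.+3%:R)^-1, n.+3%:R : R]%classic.
Proof.
apply/seteqP; split => x /=; rewrite in_itv/=.
  rewrite andbT => x0.
  have [n] : exists n, Num.max x x^-1 < n%:R.
    by exists (Num.bound (Num.max x x^-1)); rewrite archi_boundP// le_max ltW.
  rewrite gt_max => /andP[xn xVn].
  have nn : n%:R <= n.+3%:R :> R by rewrite ler_nat; do 3 apply: leqW.
  exists n => //=; rewrite in_itv/= (le_trans (ltW xn))// andbT.
  by rewrite -[leRHS]invrK lef_pV2 ?posrE ?invr_gt0 ?ltr0n// (le_trans (ltW xVn)).
move=> [n _ /=]; rewrite in_itv/= => /andP[h1 h2].
by rewrite andbT (lt_le_trans _ h1)// invr_gt0 ltr0n.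
Qed.

Lemma invS3_dec {R : realType} :
  {homo (fun n => (n.+3%:R)^-1 : R) : m n / (m <= n)%N >-> n <= m}.
Proof. by move=> m n mn; rewrite lef_pV2 ?posrE ?ltr0n// ler_nat. Qed.

Lemma invS3_lt {R : realType} n : (n.+3%:R)^-1 < n.+3%:R :> R.
Proof.
by rewrite (@lt_le_trans _ _ 1) ?invf_lt1 ?ltr1n ?ltr0n// ler1n.
Qed.

Lemma cvg_invS3 {R : realType} : (n.+3%:R)^-1 @[n --> \oo] --> (0 : R).
Proof. by have := @cvg_harmonic R; rewrite -(cvg_shiftn 2) /harmonic; under eq_fun do rewrite addn2. Qed.

Lemma cvg_powR_invS3 {R : realType} (p : R) : 0 < p ->
  ((n.+3%:R)^-1 `^ p) @[n --> \oo] --> (0 : R).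
Proof.
move=> p0; have /cvg_at_rightP := powR_cvg0 p0; apply; split.
  by move=> n; rewrite invr_gt0 ltr0n.
exact: cvg_invS3.
Qed.

Lemma integral_powR01 {R : realType} (p : R) : 0 < p ->
  lebesgue_measure.-integrable `]0, 1[ (fun x : R => (x `^ (p - 1))%:E) /\
  \int[lebesgue_measure]_(x in `]0, 1[) (x `^ (p - 1)) = p^-1.
Proof.
move=> p0.
pose F (x : R) := p^-1 * x `^ p.
pose f (x : R) := x `^ (p - 1).
have dF (x : R) : `]0, 1[%classic x -> is_derive x 1 F (f x).
  rewrite /= in_itv/= => /andP[x0 _]; have dx := is_derive1_powR p x0.
  have -> : f x = p^-1 *: (p * x `^ (p - 1)) by rewrite /f scalerA mulVf ?scale1r// gt_eqF.
  exact: is_deriveZ.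
have cf (x : R) : `]0, 1[%classic x -> {for x, continuous f}.
  by rewrite /= in_itv/= => /andP[x0 _]; exact: continuous_powR.
have F0 : F n.+3%:R^-1 @[n --> \oo] --> p^-1 * 0.
  by apply: cvgMr; exact: cvg_powR_invS3.
have F1 : F (1 - n.+3%:R^-1) @[n --> \oo] --> p^-1 * (1 - 0) `^ p.
  have cp : {for (1 - 0 : R), continuous (fun y : R => y `^ p)}.
    by apply: continuous_powR; rewrite subr0.
  apply: cvgMr; apply: (continuous_cvg _ cp).
  by apply: cvgB; [exact: cvg_cst|exact: cvg_invS3].
have [] := @integral_derive_dominated R `]0, 1[%classic
    (fun n => n.+3%:R^-1) (fun n => 1 - n.+3%:R^-1) f F f F _ _ _ _ invS3_dec _ _
    bigcup_itv01 dF dF cf cf _ F0 F1 F0 F1.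
- by move=> m n mn; rewrite lerB// invS3_dec.
- move=> n; suff : (n.+3%:R^-1 : R) <= 3^-1 by move: (n.+3%:R^-1) => e; lra.
  by rewrite lef_pV2 ?posrE ?ltr0n// ler_nat.
- by move=> x _; rewrite ger0_norm// powR_ge0.
by move=> i ->; split => //; rewrite mulr0 !subr0 powR1 mulr1.
Qed.

(** * Integrability of the integrand of Gamma *)

(** Taking logarithms, this is y ln(1 + t) <= t + const, which is
    ln z <= z - 1 at z = (1 + t) / y. *)
Lemma powR1D_expRN_bounded {R : realType} (y : R) : 0 < y ->
  exists2 C : R, 0 < C & forall t, 0 < t -> (1 + t) `^ y * expR (- t) <= C.
Proof.
move=> y0; exists (expR (1 - y + y * ln y)); first exact: expR_gt0.
move=> t t0; have t1 : 0 < 1 + t by lra.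
rewrite /powR (gt_eqF t1) -expRD ler_expR.
have : ln ((1 + t) / y) <= (1 + t) / y - 1.
  rewrite -[in leLHS](subrK 1 ((1 + t) / y)) addrC le_ln1Dx//.
  by have := divr_gt0 t1 y0; lra.
rewrite ln_div ?posrE// => /(ler_wpM2l (ltW y0)).
rewrite !mulrBr mulrCA divff ?gt_eqF// !mulr1; lra.
Qed.

(** An increasing function from 0 to 1 on ]0, +oo[ whose derivative has the
    same singularity t^(x-1) at 0 as the integrand of Gamma and decays only
    polynomially at infinity, so that it dominates t^(x-1) e^(-t). *)
Definition gamma_bound {R : realType} (x t : R) : R := (t / (1 + t)) `^ x.

Definition gamma_bound' {R : realType} (x t : R) : R :=
  x * (t / (1 + t)) `^ (x - 1) * (1 + t) ^- 2.

Lemma is_derive_gamma_bound {R : realType} (x t : R) : 0 < t ->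
  is_derive t 1 (gamma_bound x) (gamma_bound' x t).
Proof.
move=> t0; have t1 : 1 + t != 0 by rewrite gt_eqF//; lra.
have w0 : 0 < t / (1 + t) by apply: divr_gt0 => //; lra.
have dw : is_derive t 1 (fun t : R => t / (1 + t)) ((1 + t) ^- 2).
  have dV : is_derive t 1 (fun t : R => (1 + t)^-1) (- (1 + t) ^- 2 *: (0 + 1)).
    by apply: is_deriveV.
  have dM := is_deriveM (is_derive_id t 1) dV.
  apply: (is_derive_eq dM); rewrite /= /GRing.scale/=; field.
  by rewrite t1.
exact: (@is_derive1_comp _ (fun y : R => y `^ x) (fun t : R => t / (1 + t))
  t _ _ (is_derive1_powR x w0) dw).
Qed.

Lemma continuous_gamma_bound' {R : realType} (x t : R) : 0 < t ->
  {for t, continuous (gamma_bound' x)}.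
Proof.
move=> t0; have t1 : 1 + t != 0 by rewrite gt_eqF//; lra.
have w0 : 0 < t / (1 + t) by apply: divr_gt0 => //; lra.
have c1 : {for t, continuous (fun t : R => 1 + t)}.
  by apply: cvgD; [exact: cvg_cst|exact: cvg_id].
have cV : {for t, continuous (fun t : R => (1 + t)^-1)} by apply: cvgV.
have cw : {for t, continuous (fun t : R => t / (1 + t))}.
  by apply: cvgM; [exact: cvg_id|exact: cV].
have c2 : {for t, continuous (fun t : R => (t / (1 + t)) `^ (x - 1))}.
  exact: (@continuous_comp _ _ _ (fun t : R => t / (1 + t))
    (fun y : R => y `^ (x - 1)) t cw (continuous_powR w0)).
apply: cvgM; first by apply: cvgMr; exact: c2.
by apply: cvgV; [rewrite expf_neq0|rewrite !expr2; apply: cvgM; exact: c1].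
Qed.

(** The extra factor 1 + t makes a single bound serve both t^(x-1) e^(-t) and
    t^x e^(-t), the two terms of the derivative of t^x e^(-t). *)
Lemma gamma_dominated {R : realType} (x : R) : 0 < x ->
  exists2 K : R, 0 < K & forall t, 0 < t ->
    t `^ (x - 1) * (1 + t) * expR (- t) <= K * gamma_bound' x t.
Proof.
move=> x0; have [C C0 CP] := @powR1D_expRN_bounded R (x + 2) ltac:(lra).
exists (C / x); first exact: divr_gt0.
move=> t t0; have t1 : 0 < 1 + t by lra.
rewrite /gamma_bound' powRM ?invr_ge0 ?(ltW t0) ?(ltW t1)//.
rewrite -(powR_inv1 (ltW t1)) -powRrM.
have -> : C / x * (x * (t `^ (x - 1) * (1 + t) `^ (-1 * (x - 1))) * (1 + t) ^- 2) =
  t `^ (x - 1) * (C * ((1 + t) `^ (-1 * (x - 1)) * (1 + t) ^- 2)).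
  by field; rewrite !gt_eqF.
rewrite -mulrA ler_wpM2l ?powR_ge0//.
have -> : (1 + t) `^ (-1 * (x - 1)) * (1 + t) ^- 2 = (1 + t) / (1 + t) `^ (x + 2).
  rewrite -powR_invn ?(ltW t1)// -powRD; last by rewrite (gt_eqF t1) implybT.
  rewrite -[X in X / _]powRr1 ?(ltW t1)// -powRB; last by rewrite (gt_eqF t1) implybT.
  by congr (_ `^ _); lra.
rewrite mulrA ler_pdivlMr ?powR_gt0//.
have := CP t t0 => /(ler_wpM2l (ltW t1)).
by rewrite mulrC; nra.
Qed.

Lemma cvg_gamma_bound_0 {R : realType} (x : R) : 0 < x ->
  gamma_bound x (n.+3%:R^-1) @[n --> \oo] --> (0 : R).
Proof.
move=> x0; apply: (squeeze_cvgr _ (@cvg_cst _ _ _ _ _) (cvg_powR_invS3 x0)).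
apply: nearW => n; rewrite powR_ge0/=.
have u0 : 0 < n.+3%:R^-1 :> R by rewrite invr_gt0 ltr0n.
have u1 : 0 < 1 + n.+3%:R^-1 :> R by rewrite addr_gt0.
apply: ge0_ler_powR; rewrite ?nnegrE; [exact: ltW| |exact: ltW|].
  by rewrite divr_ge0 ?ltW.
by rewrite ler_pdivrMr// ler_peMr ?(ltW u0)// lerDl ltW.
Qed.

Lemma cvg_gamma_bound_y {R : realType} (x : R) : 0 < x ->
  gamma_bound x (n.+3%:R) @[n --> \oo] --> (1 `^ x : R).
Proof.
move=> x0.
have c1 : {for (1 : R), continuous (fun y : R => y `^ x)} by exact: continuous_powR.
apply: (continuous_cvg _ c1).
have -> : (fun n => n.+3%:R / (1 + n.+3%:R) : R) = (fun n => 1 - n.+4%:R^-1).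
  apply/funext => n; rewrite nat1r -[n.+4%:R]natr1.
  have : n.+3%:R + 1 != 0 :> R by rewrite natr1 pnatr_eq0.
  by move: (n.+3%:R) => m m0; field.
rewrite -[X in _ --> X]subr0; apply: cvgB; first exact: cvg_cst.
by have := @cvg_invS3 R; rewrite -(cvg_shiftn 1); under eq_fun do rewrite addn1.
Qed.

Lemma gamma_bound'_ge0 {R : realType} (x t : R) : 0 < x -> 0 <= t ->
  0 <= gamma_bound' x t.
Proof.
move=> x0 t0; rewrite mulr_ge0 ?mulr_ge0 ?powR_ge0 ?(ltW x0)// invr_ge0 exprn_ge0//.
by rewrite addr_ge0.
Qed.

Lemma integrable_gamma {R : realType} (x : R) : 0 < x ->
  lebesgue_measure.-integrable `]0, +oo[
    (fun t : R => (t `^ (x - 1) * expR (- t))%:E).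
Proof.
move=> x0; have [K K0 KP] := gamma_dominated x0.
have [iG _] : lebesgue_measure.-integrable `]0, +oo[ (EFin \o gamma_bound' x) /\
  \int[lebesgue_measure]_(t in `]0, +oo[) gamma_bound' x t = 1 `^ x - 0.
  apply: (@integral_derive_dominated R `]0, +oo[%classic (fun n => n.+3%:R^-1)
    (fun n => n.+3%:R) _ (gamma_bound x) _ (gamma_bound x) _ _ 0 (1 `^ x)).
  - exact: invS3_dec.
  - by move=> m n mn; rewrite ler_nat.
  - exact: invS3_lt.
  - exact: bigcup_itv0y.
  - by move=> t; rewrite /= in_itv/= andbT; exact: is_derive_gamma_bound.
  - by move=> t; rewrite /= in_itv/= andbT; exact: is_derive_gamma_bound.
  - by move=> t; rewrite /= in_itv/= andbT; exact: continuous_gamma_bound'.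
  - by move=> t; rewrite /= in_itv/= andbT; exact: continuous_gamma_bound'.
  - move=> t; rewrite /= in_itv/= andbT => t0.
    by rewrite ger0_norm// gamma_bound'_ge0// ltW.
  - exact: cvg_gamma_bound_0.
  - exact: cvg_gamma_bound_y.
  - exact: cvg_gamma_bound_0.
  - exact: cvg_gamma_bound_y.
apply: le_integrable (integrableZl _ K iG) => //.
  apply/measurable_EFinP/measurable_funM.
    exact: measurable_funTS (measurable_powR _).
  apply: measurable_funTS; apply: measurableT_comp => //.
move=> t /=; rewrite in_itv/= andbT => t0.
rewrite lee_fin ger0_norm ?mulr_ge0 ?powR_ge0 ?expR_ge0//.
rewrite (le_trans _ (ler_norm _))// (le_trans _ (KP t t0))//.
rewrite -mulrA ler_wpM2l ?powR_ge0// ler_peMl ?expR_ge0//; lra.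
Qed.

(** * Functional equation, positivity and log-convexity of Gamma *)

(** The derivative of t^x e^(-t) is x t^(x-1) e^(-t) - t^x e^(-t), and
    t^x e^(-t) vanishes at both ends of ]0, +oo[. *)
Lemma GammaS {R : realType} (x : R) : 0 < x -> Gamma (x + 1) = x * Gamma x.
Proof.
move=> x0; have [K K0 KP] := gamma_dominated x0.
have [y0 x1] : 0 < x + 1 /\ 0 <= x + 1 by split; lra.
have ix := integrable_gamma x0; have ix1 := integrable_gamma y0.
pose f (t : R) := x * (t `^ (x - 1) * expR (- t)) - t `^ x * expR (- t).
pose F (t : R) := t `^ x * expR (- t).
pose L := (x + 1) * K.
have FE t : 0 < t -> t `^ x = t `^ (x - 1) * t.
  by move=> t0; rewrite mulrC mulr_powRB1// ltW.
have fb t : 0 < t -> `|f t| <= L * gamma_bound' x t.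
  move=> t0; rewrite -mulrA; apply: (@le_trans _ _ ((x + 1) * (t `^ (x - 1) * (1 + t) * expR (- t)))); last first.
    by rewrite ler_wpM2l// KP.
  have -> : f t = (t `^ (x - 1) * expR (- t)) * (x - t).
    by rewrite /f FE//; ring.
  have a0 : 0 <= t `^ (x - 1) * expR (- t) by rewrite mulr_ge0 ?powR_ge0 ?expR_ge0.
  have -> : (x + 1) * (t `^ (x - 1) * (1 + t) * expR (- t)) =
    (t `^ (x - 1) * expR (- t)) * ((x + 1) * (1 + t)) by ring.
  rewrite normrM (ger0_norm a0) ler_wpM2l//.
  by rewrite ler_norml; apply/andP; split; nra.
have dF (t : R) : 0 < t -> is_derive t 1 F (f t).
  move=> t0.
  have dE : is_derive t 1 (fun s : R => expR (- s)) (expR (- t) * - 1).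
    exact: (@is_derive1_comp _ expR (fun s : R => - s) t _ _
      (is_derive_expR (- t)) (is_deriveN (is_derive_id t 1))).
  have dM := is_deriveM (is_derive1_powR x t0) dE.
  by apply: (is_derive_eq dM); rewrite /f /GRing.scale/=; ring.
have cf (t : R) : 0 < t -> {for t, continuous f}.
  move=> t0.
  have cE : {for t, continuous (fun s : R => expR (- s))}.
    exact: (@continuous_comp _ _ _ (fun s : R => - s) expR t
      (cvgN cvg_id) (@continuous_expR R (- t))).
  apply: cvgB.
    by apply: cvgMr; apply: cvgM => //; exact: continuous_powR.
  by apply: cvgM => //; exact: continuous_powR.
have F0 : F n.+3%:R^-1 @[n --> \oo] --> 0.
  apply: (squeeze_cvgr _ (@cvg_cst _ _ _ _ _) (cvg_powR_invS3 x0)).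
  apply: nearW => n; rewrite mulr_ge0 ?powR_ge0 ?expR_ge0//=.
  by rewrite ler_piMr ?powR_ge0// expR_le1 oppr_le0.
have [C C0 CP] := powR1D_expRN_bounded y0.
have Fy : F n.+3%:R @[n --> \oo] --> 0.
  have H : C * (n.+3%:R^-1 : R) @[n --> \oo] --> (C * 0 : R).
    by apply: cvgMr; exact: cvg_invS3.
  rewrite mulr0 in H; apply: (squeeze_cvgr _ (@cvg_cst _ _ _ _ _) H).
  apply: nearW => n; have n0 : 0 < n.+3%:R :> R by rewrite ltr0n.
  rewrite mulr_ge0 ?powR_ge0 ?expR_ge0//= ler_pdivlMr//.
  apply: le_trans (CP _ n0); rewrite /F mulrAC ler_wpM2r ?expR_ge0//.
  have H1 : 0 <= 1 + n.+3%:R :> R by rewrite addr_ge0.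
  have H2 : n.+3%:R <= 1 + n.+3%:R :> R by rewrite lerDr.
  rewrite -[in leRHS](mulr_powRB1 H1)// addrK mulrC ler_pM ?powR_ge0//.
  by apply: ge0_ler_powR => //; rewrite ?ltW ?nnegrE ?ltW.
have [_ If] : lebesgue_measure.-integrable `]0, +oo[ (EFin \o f) /\
  \int[lebesgue_measure]_(t in `]0, +oo[) f t = 0 - 0.
  apply: (@integral_derive_dominated R `]0, +oo[%classic (fun n => n.+3%:R^-1)
    (fun n => n.+3%:R) f F (fun t => L * gamma_bound' x t)
    (fun t => L * gamma_bound x t) _ _ (L * 0) (L * 1 `^ x)).
  - exact: invS3_dec.
  - by move=> m n mn; rewrite ler_nat.
  - exact: invS3_lt.
  - exact: bigcup_itv0y.
  - by move=> t; rewrite /= in_itv/= andbT; exact: dF.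
  - move=> t; rewrite /= in_itv/= andbT => /(is_derive_gamma_bound x) d.
    exact: is_deriveZ.
  - by move=> t; rewrite /= in_itv/= andbT; exact: cf.
  - move=> t; rewrite /= in_itv/= andbT => t0.
    by apply: cvgMr; exact: continuous_gamma_bound'.
  - by move=> t; rewrite /= in_itv/= andbT; exact: fb.
  - exact: F0.
  - exact: Fy.
  - by apply: cvgMr; exact: cvg_gamma_bound_0.
  - by apply: cvgMr; exact: cvg_gamma_bound_y.
apply/esym/eqP; rewrite -subr_eq0; apply/eqP.
rewrite -[RHS](subrr 0) -If /Gamma -RintegralZl//.
rewrite -RintegralB//; last exact: (integrableZl _ x ix).
by apply: eq_Rintegral => t _; rewrite addrK.
Qed.

(** On ]0, 1[ the integrand is at least t^(x-1) e^(-1), which gives the lower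
    bound e^(-1) / x. *)
Lemma Gamma_gt0 {R : realType} (x : R) : 0 < x -> 0 < Gamma x.
Proof.
move=> x0; have [i01 I01] := integral_powR01 x0.
have ig := integrable_gamma x0.
apply: (@lt_le_trans _ _ (x^-1 * expR (- 1))).
  by rewrite mulr_gt0 ?invr_gt0 ?expR_gt0.
rewrite -I01 -RintegralZr//.
have sub : `]0, 1[%classic `<=` (`]0, +oo[%classic : set R).
  by move=> t /=; rewrite !in_itv/= => /andP[-> _].
apply: (@le_trans _ _ (\int[lebesgue_measure]_(t in `]0, 1[)
    (t `^ (x - 1) * expR (- t)))).
  apply: le_Rintegral => //.
  - exact: (integrableZr _ _ i01).
  - exact: integrableS ig.
  - move=> t /=; rewrite in_itv/= => /andP[t0 t1].
    by rewrite ler_wpM2l ?powR_ge0// ler_expR lerN2 ltW.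
rewrite /Gamma /Rintegral; apply: fine_le.
- exact: integrable_fin_num (integrableS _ _ _ ig).
- exact: integrable_fin_num ig.
- apply: ge0_subset_integral => //.
  + exact: measurable_int ig.
  + by move=> t _; rewrite lee_fin mulr_ge0 ?powR_ge0 ?expR_ge0.
Qed.

(** Hoelder's inequality, through its pointwise source: after dividing
    t^(x-1) e^(-t) by Gamma x, and likewise for y, convexity of the exponential
    bounds the weighted geometric mean of the two functions by their weighted
    arithmetic mean, whose integral is 1. *)
Lemma ln_Gamma_convex {R : realType} (a x y : R) : 0 < x -> 0 < y ->
  0 <= a <= 1 ->
  ln (Gamma (a * x + (1 - a) * y)) <=
  a * ln (Gamma x) + (1 - a) * ln (Gamma y).
Proof.
move=> x0 y0 /andP[a0 a1].
have z0 : 0 < a * x + (1 - a) * y by nra.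
set z := a * x + (1 - a) * y in z0 *.
have ix := integrable_gamma x0; have iy := integrable_gamma y0.
have iz := integrable_gamma z0.
have Gx := Gamma_gt0 x0; have Gy := Gamma_gt0 y0; have Gz := Gamma_gt0 z0.
set M := a * ln (Gamma x) + (1 - a) * ln (Gamma y).
(* The weights a and 1 - a are kept apart to be matched with the two integrals. *)
suff : Gamma z * expR (- M) <= a + (1 - a).
  rewrite expRN subrKC ler_pdivrMr ?expR_gt0// mul1r.
  by rewrite -ler_expR lnK.
rewrite {1}/Gamma -RintegralZr//.
have -> : a + (1 - a) = a / Gamma x * Gamma x + (1 - a) / Gamma y * Gamma y.
  by rewrite !divfK// gt_eqF.
rewrite {2}/Gamma {3}/Gamma -!RintegralZl// -RintegralD//; last 2 first.
- exact: (integrableZl _ _ ix).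
- exact: (integrableZl _ _ iy).
apply: le_Rintegral => //.
- exact: (integrableZr _ _ iz).
- exact: (integrableD _ (integrableZl _ _ ix) (integrableZl _ _ iy)).
move=> t /=; rewrite in_itv/= andbT => t0.
pose u := (x - 1) * ln t - t - ln (Gamma x).
pose v := (y - 1) * ln t - t - ln (Gamma y).
have Eexp w : Gamma w > 0 ->
    t `^ (w - 1) * expR (- t) / Gamma w = expR ((w - 1) * ln t - t - ln (Gamma w)).
  by move=> Gw; rewrite /powR (gt_eqF t0) !expRD (expRN (ln _)) lnK.
have -> : t `^ (z - 1) * expR (- t) * expR (- M) = expR (a * u + (1 - a) * v).
  by rewrite /powR (gt_eqF t0) -!expRD; congr expR; rewrite /z /M /u /v; ring.
have -> : a / Gamma x * (t `^ (x - 1) * expR (- t)) +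
    (1 - a) / Gamma y * (t `^ (y - 1) * expR (- t)) =
    a * expR u + (1 - a) * expR v by rewrite -!Eexp//; ring.
by have := convex_expR (Itv01 a0 a1) u v; rewrite !convRE.
Qed.

(** * Differentiability of ln Gamma and the digamma function *)

(** The two properties of ln Gamma from which its differentiability is derived.
    Convexity and the difference equation together determine L up to an
    additive constant (Bohr-Mollerup). *)
Definition convex_ln_primitive {R : realType} (L : R -> R) : Prop :=
  (forall x, 0 < x -> L (x + 1) = L x + ln x) /\
  (forall a x y, 0 < x -> 0 < y -> 0 <= a <= 1 ->
    L (a * x + (1 - a) * y) <= a * L x + (1 - a) * L y).

Lemma convex_ln_primitive_lnGamma {R : realType} :
  convex_ln_primitive (fun x : R => ln (Gamma x)).
Proof.
split => [x x0|a x y]; last exact: ln_Gamma_convex.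
by rewrite GammaS// lnM ?posrE ?Gamma_gt0// addrC.
Qed.

Lemma convex_chord {R : realType} (L : R -> R) (x y z : R) :
  convex_ln_primitive L -> 0 < x -> x <= y <= z -> x < z ->
  (z - x) * L y <= (z - y) * L x + (y - x) * L z.
Proof.
move=> [_ cL] x0 /andP[xy yz] xz; have d0 : 0 < z - x by lra.
pose a := (z - y) / (z - x).
have a01 : 0 <= a <= 1.
  by rewrite divr_ge0 ?(ltW d0)/= ?ler_pdivrMr ?mul1r; lra.
have aE : (z - x) * a = z - y by rewrite mulrC divfK// gt_eqF.
have := cL a x z x0 (lt_trans x0 xz) a01.
have -> : a * x + (1 - a) * z = y.
  have -> : a * x + (1 - a) * z = z - (z - x) * a by ring.
  by rewrite aE; ring.
move=> /(ler_wpM2l (ltW d0)) /le_trans; apply.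
have -> : (z - x) * (a * L x + (1 - a) * L z) =
  (z - x) * a * L x + (z - x - (z - x) * a) * L z by ring.
by rewrite aE; lra.
Qed.

(** By convexity the chord between x and h + x has a slope between those of the
    chords [x - 1, x] and [x, x + 1], which are ln(x - 1) and ln x. *)
Lemma convex_slope {R : realType} (L : R -> R) (x h : R) :
  convex_ln_primitive L -> 1 < x -> 0 < `|h| < 1 ->
  ln (x - 1) <= h^-1 * (L (h + x) - L x) <= ln x.
Proof.
move=> cL x1 /andP[]; rewrite normr_gt0 => hn0 h1.
have x0 : 0 < x by lra.
have LS := cL.1 x x0.
have LP : L x = L (x - 1) + ln (x - 1).
  by rewrite -cL.1 ?subrK//; lra.
case: (ltgtP h 0) hn0 => // hs _; move: h1.
- rewrite ltr0_norm// => h1.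
  have [a1 a2 a3] : [/\ 0 < x - 1, x - 1 <= h + x <= x & x - 1 < x] by split; lra.
  have [b1 b2 b3] : [/\ 0 < h + x, h + x <= x <= x + 1 & h + x < x + 1] by split; lra.
  have A := convex_chord cL a1 a2 a3; have B := convex_chord cL b1 b2 b3.
  rewrite ler_ndivlMl// ler_ndivrMl//.
  by move: A B; rewrite LS LP; lra.
- rewrite gtr0_norm// => h1.
  have [a1 a2 a3] : [/\ 0 < x - 1, x - 1 <= x <= h + x & x - 1 < h + x] by split; lra.
  have [b1 b2 b3] : [/\ 0 < x, x <= h + x <= x + 1 & x < x + 1] by split; lra.
  have A := convex_chord cL a1 a2 a3; have B := convex_chord cL b1 b2 b3.
  rewrite ler_pdivlMl// ler_pdivrMl//.
  by move: A B; rewrite LS LP; lra.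
Qed.

Definition sum_ln {R : realType} (n : nat) (x : R) : R := \sum_(k < n) ln (x + k%:R).

Lemma convex_ln_primitiveD {R : realType} (L : R -> R) (n : nat) (x : R) :
  convex_ln_primitive L -> 0 < x ->
  L (x + n%:R) = L x + sum_ln n x.
Proof.
move=> cL x0; elim: n => [|n IH]; first by rewrite /sum_ln big_ord0 !addr0.
by rewrite -natr1 addrA cL.1 ?ltr_wpDr// IH /sum_ln big_ord_recr/= addrA.
Qed.

Lemma is_derive_sum_ln {R : realType} (n : nat) (x : R) : 0 < x ->
  is_derive x 1 (sum_ln n) (\sum_(k < n) (x + k%:R)^-1).
Proof.
move=> x0.
have -> : sum_ln n = \sum_(k < n) (fun y : R => ln (y + k%:R)).
  by apply/funext => y; rewrite fct_sumE.
apply: is_derive_sum => k.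
have xk0 : 0 < x + k%:R by rewrite ltr_wpDr.
have d1 : is_derive x 1 (fun y : R => y + k%:R) (1 + 0).
  exact: (is_deriveD (is_derive_id x 1) (is_derive_cst _ x 1)).
have := @is_derive1_comp _ (@ln R) (fun y : R => y + k%:R) x _ _ (is_derive1_ln xk0) d1.
by rewrite addr0 mulr1.
Qed.

Lemma ln_diff_le {R : realType} (x y : R) : 0 < x -> 0 < y ->
  ln y - ln x <= (y - x) / x.
Proof.
move=> x0 y0; rewrite -ln_div ?posrE//.
have -> : y / x = 1 + (y - x) / x by field; rewrite gt_eqF.
apply: le_ln1Dx; rewrite ltr_pdivlMr//; lra.
Qed.

(** The difference quotient of L at x is the one at x + n minus the one of
    [sum_ln n]. The former stays between ln(x + n - 1) and ln(x + n), which are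
    arbitrarily close for large n, and the latter converges, so the quotients at
    x satisfy the Cauchy criterion. *)
Lemma derivable_convex_ln_primitive {R : realType} (L : R -> R) (x : R) :
  convex_ln_primitive L -> 0 < x -> derivable L x 1.
Proof.
move=> cL x0; apply: cauchy_cvg; apply: cauchy_exP => e e0.
have [n n0] : exists n : nat, 2 / e < n%:R - 1.
  exists (Num.bound (2 / e) + 1)%N.
  by rewrite natrD addrK archi_boundP// divr_ge0 ?ltW.
have e20 : 0 < 2 / e by rewrite divr_gt0.
have xn : 2 / e < x + n%:R - 1 by lra.
have lnn : ln (x + n%:R) - ln (x + n%:R - 1) < e / 2.
  apply: (le_lt_trans (ln_diff_le _ _)); [lra|lra|].
  rewrite opprB addrC subrK mul1r.
  by rewrite -[ltRHS]invrK invf_div ltf_pV2 ?posrE//; lra.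
have [dS SE] := is_derive_sum_ln n x0.
set d := \sum_(k < n) _ in SE.
have Scvg : h^-1 * (sum_ln n (h + x) - sum_ln n x) @[h --> 0^'] --> d.
  rewrite -SE (_ : (fun h => _) =
    fun h => h^-1 *: ((sum_ln n \o shift x) (h *: 1) - sum_ln n x)); first exact: dS.
  by apply/funext => h; rewrite /GRing.scale/= mulr1.
exists (ln (x + n%:R) - d).
suff : \forall h \near (0 : R)^',
    `|ln (x + n%:R) - d - h^-1 * (L (h + x) - L x)| < e.
  apply: filterS => h; rewrite /ball/= /GRing.scale/= mulr1; exact.
near=> h.
have hx : 0 < h + x.
  have : `|h| < x by near: h; exact: dnbhs0_lt.
  by rewrite ltr_norml; lra.
have h1 : 0 < `|h| < 1.
  apply/andP; split; first by rewrite normr_gt0; near: h; exact: nbhs_dnbhs_neq.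
  by near: h; exact: dnbhs0_lt.
have hS : `|d - h^-1 * (sum_ln n (h + x) - sum_ln n x)| < e / 2.
  by near: h; move/cvgrPdist_lt : Scvg; apply; lra.
have /andP[sl su] : ln (x + n%:R - 1) <= h^-1 * (L (h + (x + n%:R)) - L (x + n%:R))
   <= ln (x + n%:R) by apply: convex_slope => //; lra.
rewrite addrA !(convex_ln_primitiveD _ cL)// in sl su.
move: hS sl su; rewrite !ltr_norml.
have -> : L (h + x) + sum_ln n (h + x) - (L x + sum_ln n x)
  = (L (h + x) - L x) + (sum_ln n (h + x) - sum_ln n x) by ring.
rewrite mulrDr; lra.
Unshelve. all: by end_near. Qed.

Lemma is_derive_lnGamma {R : realType} (x : R) : 0 < x ->
  is_derive x 1 (fun x : R => ln (Gamma x)) (digamma x).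
Proof.
move=> x0; split; last by rewrite /digamma derive1E.
exact: derivable_convex_ln_primitive convex_ln_primitive_lnGamma x0.
Qed.

Lemma digammaS {R : realType} (x : R) : 0 < x ->
  digamma (x + 1) = digamma x + x^-1.
Proof.
move=> x0; have x10 : 0 < x + 1 by rewrite ltr_wpDr.
have d1 : is_derive x 1 (fun y : R => y + 1) (1 + 0).
  exact: (is_deriveD (is_derive_id x 1) (is_derive_cst _ x 1)).
have [_ dl] := @is_derive1_comp _ (fun x : R => ln (Gamma x))
  (fun y : R => y + 1) x _ _ (is_derive_lnGamma x10) d1.
have [_ dr] := is_deriveD (is_derive_lnGamma x0) (is_derive1_ln x0).
rewrite addr0 mulr1 in dl; rewrite -dl -dr.
apply: near_eq_derive; near=> y; apply: (convex_ln_primitive_lnGamma.1 y).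
by near: y; exact: lt_nbhsr.
Unshelve. all: by end_near. Qed.

Lemma digamma_bounds {R : realType} (x : R) : 1 < x ->
  ln (x - 1) <= digamma x <= ln x.
Proof.
move=> x1; have x0 : 0 < x by rewrite (lt_trans _ x1).
have [H <-] := is_derive_lnGamma x0.
rewrite /derive; apply/andP; split; [apply: limr_ge => //|apply: limr_le => //].
all: near=> h; rewrite /GRing.scale/= mulr1.
all: have h1 : 0 < `|h| < 1 by
  (apply/andP; split; [rewrite normr_gt0; near: h; exact: nbhs_dnbhs_neq|
   near: h; exact: dnbhs0_lt]).
all: by case/andP: (convex_slope convex_ln_primitive_lnGamma x1 h1).
Unshelve. all: by end_near. Qed.

(** * Euler's integral and the comparison with digamma *)

Definition digamma_kernel {R : realType} (q x : R) : R :=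
  (1 - x `^ (q - 1)) / (1 - x).

(** Euler's integral for the harmonic numbers: its value at n + 1 is
    1 + 1/2 + ... + 1/n. *)
Definition digamma_integral {R : realType} (q : R) : R :=
  \int[lebesgue_measure]_(x in `]0, 1[) digamma_kernel q x.

Lemma onemX_le {R : realType} (n : nat) (x : R) : 0 <= x <= 1 ->
  1 - x ^+ n <= n%:R * (1 - x).
Proof.
move=> /andP[x0 x1]; elim: n => [|n IH]; first by rewrite expr0 subrr mul0r.
have := exprn_ile1 n x0 x1; have := exprn_ge0 n x0.
by rewrite exprS -natr1; nra.
Qed.

Lemma digamma_kernelS {R : realType} (q x : R) : 0 < q -> 0 < x < 1 ->
  digamma_kernel (q + 1) x = digamma_kernel q x + x `^ (q - 1).
Proof.
move=> q0 /andP[x0 x1]; rewrite /digamma_kernel addrK -(mulr_powRB1 (ltW x0) q0).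
by field; rewrite subr_eq0 gt_eqF.
Qed.

Lemma digamma_kernel_ge0 {R : realType} (q x : R) : 1 <= q -> 0 < x < 1 ->
  0 <= digamma_kernel q x.
Proof.
move=> q1 /andP[x0 x1]; rewrite divr_ge0 ?subr_ge0 ?(ltW x1)//.
rewrite -[leRHS](powRr0 x) ger_powR ?subr_ge0//; lra.
Qed.

Lemma digamma_kernel_le {R : realType} (n : nat) (q x : R) :
  q - 1 <= n%:R -> 0 < x < 1 -> digamma_kernel q x <= n%:R.
Proof.
move=> qn /andP[x0 x1]; rewrite ler_pdivrMr ?subr_gt0//.
apply: le_trans (onemX_le _ _); last by rewrite !ltW.
rewrite lerB// -powR_mulrn; last exact: ltW.
by apply: ger_powR qn; rewrite x0 ltW.
Qed.

(** The kernel lies between -x^(q-1) and any integer n >= q: the lower bound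
    holds because the kernel at q + 1 is nonnegative, the upper one because
    1 - x^n <= n (1 - x). *)
Lemma integrable_digamma_kernel {R : realType} (q : R) : 0 < q ->
  lebesgue_measure.-integrable `]0, 1[ (EFin \o digamma_kernel q).
Proof.
move=> q0; have [ip _] := integral_powR01 q0.
pose n := (Num.bound q).
have qn : q < n%:R by rewrite archi_boundP// ltW.
have ic : lebesgue_measure.-integrable (`]0, 1[%classic : set R) (EFin \o cst (n%:R : R)).
  apply: measurable_bounded_integrable => //; last exact: bounded_cst.
  by rewrite /= lebesgue_measure_itv/=; case: ifPn => // _; rewrite -EFinB ltry.
apply: le_integrable (integrableD _ ip ic) => //.
  apply/measurable_EFinP; apply: open_continuous_measurable_fun => // x.
  rewrite inE/= in_itv/= => /andP[x0 x1]; apply: cvgM.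
    by apply: cvgB; [exact: cvg_cst|exact: continuous_powR].
  apply: cvgV; first by rewrite subr_eq0 gt_eqF.
  by apply: cvgB; [exact: cvg_cst|exact: cvg_id].
move=> x /=; rewrite in_itv/= => x01.
have k1 : 0 <= digamma_kernel (q + 1) x by apply: digamma_kernel_ge0 => //; lra.
have k2 : digamma_kernel q x <= n%:R by apply: digamma_kernel_le => //; lra.
have xp := powR_ge0 x (q - 1).
have n0 : 0 <= n%:R :> R by [].
rewrite digamma_kernelS// in k1.
rewrite lee_fin (le_trans _ (ler_norm _))// ler_norml; lra.
Qed.

Lemma digamma_integralS {R : realType} (q : R) : 0 < q ->
  digamma_integral (q + 1) = digamma_integral q + q^-1.
Proof.
move=> q0; have [ip <-] := integral_powR01 q0.
rewrite -RintegralD//; last exact: integrable_digamma_kernel.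
apply: eq_Rintegral => x; rewrite inE/= in_itv/= => x01.
exact: digamma_kernelS.
Qed.

Lemma le_digamma_integral {R : realType} (p q : R) : 0 < p -> p <= q ->
  digamma_integral p <= digamma_integral q.
Proof.
move=> p0 pq; apply: le_Rintegral => //.
- exact: integrable_digamma_kernel.
- by apply: integrable_digamma_kernel; exact: lt_le_trans pq.
move=> x /=; rewrite in_itv/= => /andP[x0 x1].
rewrite ler_pM2r ?invr_gt0 ?subr_gt0// lerB//.
by apply: ger_powR; rewrite ?lerD2r// x0 ltW.
Qed.

(** The function f - g is 1-periodic, so f q - f p - (g q - g p) may be computed
    at q + n and p + n. With m > q - p and y = p + n - 1, the logarithmic bounds
    make the increment of f at most (m + 1) / y in absolute value, and those of g
    lie between 0 and the increment over m unit steps, at most m / y. *)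
Lemma eq_increment_harmonic {R : realType} (f g : R -> R) (p q : R) :
  (forall x, 0 < x -> f (x + 1) = f x + x^-1) ->
  (forall x, 0 < x -> g (x + 1) = g x + x^-1) ->
  (forall x, 1 < x -> ln (x - 1) <= f x <= ln x) ->
  (forall x y, 0 < x -> x <= y -> g x <= g y) ->
  0 < p -> p <= q -> f q - f p = g q - g p.
Proof.
move=> fS gS fln gle p0 pq; have q0 : 0 < q by lra.
pose D (x : R) := f x - g x.
have DD (n : nat) x : 0 < x -> D (x + n%:R) = D x.
  move=> x0; elim: n => [|n <-]; first by rewrite addr0.
  rewrite /D -natr1 addrA fS ?gS ?ltr_wpDr//; lra.
have gD (k : nat) x : 0 < x -> g (x + k%:R) <= g x + k%:R / x.
  move=> x0; elim: k => [|k IH]; first by rewrite mul0r !addr0.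
  rewrite -natr1 addrA gS ?ltr_wpDr// mulrDl div1r addrA lerD//.
  by rewrite lef_pV2 ?posrE ?ltr_wpDr// lerDl.
pose m := Num.bound (q - p).
have qm : q - p < m%:R by rewrite archi_boundP// subr_ge0.
suff : D q - D p = 0 by rewrite /D; lra.
apply/eqP; rewrite -normr_eq0 eq_le normr_ge0 andbT.
apply/ler_addgt0Pl => e e0; rewrite addr0.
pose C : R := m%:R + 1.
have C0 : 0 < C by rewrite ltr_wpDl.
have [n [n1 nC]] : exists n : nat, 1 <= n%:R :> R /\ C / e < n%:R - 1.
  exists (Num.bound (C / e) + 1)%N; rewrite ler1n addn1; split => //.
  by rewrite -addn1 natrD addrK archi_boundP// divr_ge0 ?ltW.
pose y := p + n%:R - 1.
have yC : C / e < y by rewrite /y; lra.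
have y0 : 0 < y by apply: lt_trans yC; rewrite divr_gt0.
have Cy : C / y < e by rewrite ltr_pdivrMr// mulrC -ltr_pdivrMr.
have bq := fln (q + n%:R) ltac:(lra).
have bp := fln (p + n%:R) ltac:(rewrite /y in y0; lra).
have I1 := gle (p + n%:R) (q + n%:R) ltac:(lra) ltac:(lra).
have I2 := gle (q + n%:R) (p + n%:R + m%:R) ltac:(lra) ltac:(lra).
have I3 := gD m (p + n%:R) ltac:(lra).
have I4 : m%:R / (p + n%:R) <= m%:R / y.
  by rewrite ler_wpM2l// lef_pV2 ?posrE /y; lra.
have L1 := @ln_diff_le _ y (q + n%:R) y0 ltac:(lra).
have L2 := @ln_diff_le _ y (p + n%:R) y0 ltac:(lra).
have L3 : ln y <= ln (q + n%:R - 1) by rewrite ler_ln ?posrE /y; rewrite /y in y0; lra.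
have L4 : (q + n%:R - y) / y <= C / y.
  by rewrite ler_wpM2r ?invr_ge0 ?(ltW y0)// /y /C; lra.
have L5 : (p + n%:R - y) / y <= y^-1.
  by rewrite ler_piMl ?invr_ge0 ?(ltW y0)// /y; lra.
have CE : C / y = m%:R / y + y^-1 by rewrite /C mulrDl mul1r.
rewrite -(DD n q q0) -(DD n p p0) ler_norml /D.
rewrite -/y in bp; move: bp bq => /andP[b1 b2] /andP[b3 b4].
lra.
Qed.

Lemma digammaB {R : realType} (p q : R) : 0 < p -> 0 < q ->
  digamma q - digamma p = digamma_integral q - digamma_integral p.
Proof.
have main (x y : R) : 0 < x -> x <= y ->
    digamma y - digamma x = digamma_integral y - digamma_integral x.
  apply: eq_increment_harmonic => *.
  - exact: digammaS.
  - exact: digamma_integralS.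
  - exact: digamma_bounds.
  - exact: le_digamma_integral.
move=> p0 q0; have [pq|/ltW qp] := leP p q; first exact: main.
by apply: oppr_inj; rewrite !opprB; exact: main.
Qed.

Unset Implicit Arguments.

Theorem proposition3p1 (R : realType) (p q : R) (hp : 0 < p) (hq : 0 < q) :
  (\int[lebesgue_measure]_(x in `]0%R, 1%R[)
     ((x `^ (p - 1) - x `^ (q - 1)) / (1 - x))%:E)%E
  = (digamma q - digamma p)%:E.
Proof.
have ip := integrable_digamma_kernel hp; have iq := integrable_digamma_kernel hq.
rewrite digammaB// /digamma_integral -RintegralB// fineK; last first.
  exact: integrable_fin_num (integrableB _ iq ip).
apply: eq_integral => x _; congr EFin.
by rewrite -mulrBl; congr (_ * _); ring.
Qed.
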